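(* Let $X$ be a metric space and let $n\ge 0$ be an integer. Suppose that for every $\epsilon>0$ there is $\delta>0$ such that the following holds: for every simplicial complex $K$, every subset $A\subset X$, every $\delta$-partition of unity $f\colon X\to K$ and every function $g\colon A\to K^{(n)}$ such that $f|_A=i\circ g$, where $i\colon K^{(n)}\to K$ is the inclusion, there is a filler $h\colon X\to K^{(n)}$ that is an $\epsilon$-partition of unity. (Here $h$ being a filler means that $h|_A=g$ and that, for every $x\in X$ and every simplex $\Delta$ of $K$, $f(x)\in\Delta$ implies $h(x)\in\Delta$.) If $X$ is large scale paracompact, then the asymptotic dimension of $X$ is at most $n$.
   Context: A family of subsets of a metric space is uniformly bounded if the diameters of its elements have a finite common upper bound. Asymptotic dimension. $X$ has asymptotic dimension at most $n$ if for every uniformly bounded cover $\mathcal{U}$ of $X$ there is a uniformly bounded cover $\mathcal{V}$ of $X$ such that every element $U$ of $\mathcal{U}$ intersects at most $n+1$ elements of $\mathcal{V}$. Simplicial complexes. For a set $S$, the full complex $\Delta(S)$ is the set of finitely supported functions $f\colon S\to[0,1]$ with $\sum_{s\in S}f(s)=1$, with the metric inherited from $l^1(S)$. A simplicial complex $K$ is a subcomplex of some $\Delta(S)$, with the induced $l^1$-metric; $K^{(0)}$ is its set of vertices and $K^{(n)}$ its $n$-skeleton. The star $st(v)$ of a vertex $v$ is the set of all $f\in K$ with $f(v)>0$. For $f\colon X\to K$ and $v\in K^{(0)}$ put $f_v(x):=f(x)(v)$. $\delta$-partitions of unity. A function $f$ between metric spaces is $(\lambda,C)$-Lipschitz if $d(f(x),f(y))\le\lambda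 d(x,y)+C$ for all $x,y$. For $\delta>0$, a function $f\colon X\to K$ is a $\delta$-partition of unity if it is $(\delta,\delta)$-Lipschitz, the cover $\mathcal{V}:=\{f^{-1}(st(v))\}_{v\in K^{(0)}}$ of $X$ is uniformly bounded, and the Lebesgue number of $\mathcal{V}$ is at least $\frac1\delta$ (a cover has Lebesgue number at least $r$ if every subset of $X$ of diameter less than $r$ is contained in some element of the cover). Large scale paracompactness. For a cover $\mathcal{U}$ of $X$ and $f\colon X\to K$, $var_{\mathcal{U}}(f)$ is the supremum of $d(f(x),f(y))$ over all $x,y$ contained in a common element of $\mathcal{U}$. A function $f\colon X\to K$ is a $(\mathcal{U},\epsilon)$-partition of unity if: (i) $var_{\mathcal{U}}(f)<\epsilon$; (ii) for every $U\in\mathcal{U}$ there is $v\in K^{(0)}$ with $f_v(y)>0$ for all $y\in U$; (iii) $\{f^{-1}(st(v))\}_{v\in K^{(0)}}$ is a uniformly bounded cover of $X$. $X$ is large scale paracompact if for every uniformly bounded cover $\mathcal{U}$ of $X$ and every $\epsilon>0$ there is a $(\mathcal{U},\epsilon)$-partition of unity $f\colon X\to K$ for some simplicial complex $K$. *)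

(* Defs.v *)
From HB Require Import structures.
From mathcomp Require Export all_boot all_order all_algebra.
From mathcomp Require Export finmap.
From mathcomp Require Export mathcomp_extra boolp classical_sets functions.
From mathcomp Require Export cardinality reals ereal topology.

Set Implicit Arguments.
Unset Strict Implicit.
Unset Printing Implicit Defensive.

Import Order.TTheory GRing.Theory Num.Theory.

Local Open Scope fset_scope.
Local Open Scope classical_set_scope.
Local Open Scope ring_scope.

(* Families of subsets of [X] are sets of sets, so that the number of elements
   of a family counts distinct subsets. *)

Section LargeScale.
Context {R : realType} {X : metricType R}.
Implicit Types (A : set X) (U V : set (set X)).

(* The maximum with 0 only serves to make the diameter of [set0] equal to 0
   instead of -oo. *)
Definition diam A : \bar R :=
  Order.max 0%E (ereal_sup [set (mdist p.1 p.2)%:E | p in A `*` A]).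

Definition uniformly_bounded U : Prop :=
  exists M : R, forall A, U A -> (diam A <= M%:E)%E.

Definition is_cover U : Prop := \bigcup_(A in U) A = setT.

Definition uniformly_bounded_cover U : Prop :=
  is_cover U /\ uniformly_bounded U.

Definition lebesgue_number_ge (r : R) U : Prop :=
  forall A, (diam A < r%:E)%E -> exists2 B, U B & A `<=` B.

End LargeScale.

Definition asdim_le {R : realType} (X : metricType R) (n : nat) : Prop :=
  forall U : set (set X), uniformly_bounded_cover U ->
  exists V : set (set X), uniformly_bounded_cover V /\
    forall A, U A -> ([set B | V B /\ A `&` B !=set0] #<= `I_n.+1)%card.

Definition coarse_lipschitz {R : realType} {X Y : metricType R}
    (lam C : R) (f : X -> Y) : Prop :=
  forall x y, mdist (f x) (f y) <= lam * mdist x y + C.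

Definition variation {R : realType} {X Y : metricType R}
    (U : set (set X)) (f : X -> Y) : \bar R :=
  ereal_sup [set (mdist (f p.1) (f p.2))%:E |
              p in [set p : X * X | exists A, [/\ U A, A p.1 & A p.2]]].

Record full_complex (R : realType) (S : choiceType) := FullComplex {
  bary : {fsfun S -> R with 0};
  _ : `[< (forall s, 0 <= bary s <= 1) /\ \sum_(s <- finsupp bary) bary s = 1 >]
}.
Coercion bary : full_complex >-> fsfun.

HB.instance Definition _ (R : realType) (S : choiceType) :=
  [isSub for @bary R S].
HB.instance Definition _ (R : realType) (S : choiceType) :=
  [Choice of full_complex R S by <:].

Section L1Metric.
Context {R : realType} {S : choiceType}.
Implicit Types f g h : full_complex R S.

Definition l1dist f g : R :=
  \sum_(s <- (finsupp f `|` finsupp g)%fset) `|f s - g s|.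

Lemma l1dist_supp f g (D : {fset S}) :
  (finsupp f `|` finsupp g `<=` D)%fset ->
  l1dist f g = \sum_(s <- D) `|f s - g s|.
Proof.
move=> sD; apply: big_fset_incl => // s _.
by rewrite in_fsetU negb_or => /andP[fs gs]; rewrite !fsfun_dflt// subrr normr0.
Qed.

Lemma l1distxx f : l1dist f f = 0.
Proof. by rewrite /l1dist big1// => s _; rewrite subrr normr0. Qed.

Lemma l1dist_positivity f g : l1dist f g = 0 -> f = g.
Proof.
move=> /eqP; rewrite psumr_eq0; last by move=> *; exact: normr_ge0.
move=> /allP fg0; apply: val_inj; apply/fsfunP => s /=.
have [sfg|] := boolP (s \in (finsupp f `|` finsupp g)%fset).
  by have := fg0 s sfg; rewrite /= normr_eq0 subr_eq0 => /eqP.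
by rewrite in_fsetU negb_or => /andP[fs gs]; rewrite !fsfun_dflt.
Qed.

Lemma l1dist_sym f g : l1dist f g = l1dist g f.
Proof.
by rewrite /l1dist fsetUC; apply: eq_bigr => s _; rewrite distrC.
Qed.

Lemma l1dist_triangle g f h : l1dist f h <= l1dist f g + l1dist g h.
Proof.
pose D := (finsupp f `|` finsupp g `|` finsupp h)%fset.
rewrite !(@l1dist_supp _ _ D); first last.
- by apply/fsubsetP => s; rewrite !in_fsetU => /orP[] ->; rewrite ?orbT.
- by apply/fsubsetP => s; rewrite !in_fsetU => /orP[] ->; rewrite ?orbT.
- by apply/fsubsetP => s; rewrite !in_fsetU => /orP[] ->; rewrite ?orbT.
by rewrite -big_split/=; apply: ler_sum => s _; exact: ler_distD.
Qed.

End L1Metric.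

HB.instance Definition _ (R : realType) (S : choiceType) :=
  @isMetric.Build R (full_complex R S) l1dist
    l1distxx l1dist_positivity l1dist_sym l1dist_triangle.

(** A subcomplex of the full complex on [S] is given by the finite nonempty
    subsets of [S] that span its simplices; [realization] is the
    corresponding set of points of the full complex. *)

Record simplicial_complex (S : choiceType) := SimplicialComplex {
  simplices : set {fset S};
  simplices_neq0 : forall s, simplices s -> s != fset0;
  simplices_face : forall s t, simplices s -> t != fset0 ->
    (t `<=` s)%fset -> simplices t
}.

Section SkeletonDef.
Context {S : choiceType} (n : nat) (K : simplicial_complex S).

Definition skeleton_simplices : set {fset S} :=
  [set s | simplices K s /\ (#|` s| <= n.+1)%N].

Lemma skeleton_neq0 s : skeleton_simplices s -> s != fset0.
Proof. by move=> [/simplices_neq0]. Qed.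

Lemma skeleton_face s t : skeleton_simplices s -> t != fset0 ->
  (t `<=` s)%fset -> skeleton_simplices t.
Proof.
move=> [Ks sn] t0 ts; split; first exact: simplices_face Ks t0 ts.
exact: leq_trans (fsubset_leq_card ts) sn.
Qed.

Definition skeleton : simplicial_complex S :=
  SimplicialComplex skeleton_neq0 skeleton_face.

End SkeletonDef.

Section Realization.
Context {R : realType} {S : choiceType} (K : simplicial_complex S).

Definition realization : set (full_complex R S) :=
  [set p | simplices K (finsupp p)].

(* A vertex is identified with the corresponding element of [S]. *)
Definition vertices : set S := [set v | simplices K [fset v]%fset].

Definition star (v : S) : set (full_complex R S) :=
  [set p | realization p /\ 0 < p v].

End Realization.
Arguments realization R {S} K.

Definition closed_simplex {R : realType} {S : choiceType} (s : {fset S}) :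
  set (full_complex R S) := [set p | (finsupp p `<=` s)%fset].

(** A function [X -> K] is a [{fun [set: X] >-> realization R K}]; a function
    [A -> K] is a [{fun A >-> realization R K}], whose values outside [A] are
    irrelevant. *)

Section Partitions.
Context {R : realType} {X : metricType R} {S : choiceType}.
Variable K : simplicial_complex S.
Implicit Type f : {fun [set: X] >-> realization R K}.

Definition star_cover f : set (set X) :=
  [set f @^-1` star K v | v in vertices K].

Definition delta_partition_of_unity (delta : R) f : Prop :=
  [/\ coarse_lipschitz delta delta f,
      uniformly_bounded_cover (star_cover f)
    & lebesgue_number_ge delta^-1 (star_cover f)].

Definition cover_partition_of_unity (U : set (set X)) (eps : R) f : Prop :=
  [/\ (variation U f < eps%:E)%E,
      forall A, U A -> exists2 v, vertices K v & forall y, A y -> 0 < f y v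
    & uniformly_bounded_cover (star_cover f)].

End Partitions.

Definition large_scale_paracompact {R : realType} (X : metricType R) : Prop :=
  forall (U : set (set X)) (eps : R), uniformly_bounded_cover U -> 0 < eps ->
  exists (S : choiceType) (K : simplicial_complex S)
         (f : {fun [set: X] >-> realization R K}),
    cover_partition_of_unity U eps f.

Definition is_filler {R : realType} {X : metricType R} {S : choiceType}
    (K : simplicial_complex S) (n : nat) (A : set X)
    (f : {fun [set: X] >-> realization R K})
    (g : {fun A >-> realization R (skeleton n K)})
    (h : {fun [set: X] >-> realization R (skeleton n K)}) : Prop :=
  {in A, h =1 g} /\
  forall x s, simplices K s -> closed_simplex s (f x) -> closed_simplex s (h x).

(* Main.v *)
Require Import Defs.
From mathcomp Require Import lra.

Set Implicit Arguments.
Unset Strict Implicit.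
Unset Printing Implicit Defensive.

Import Order.TTheory GRing.Theory Num.Theory.

Local Open Scope classical_set_scope.
Local Open Scope ring_scope.

(** Why the theorem holds.

    Any two points of a full complex are at l1-distance at most 2, so the
    inequality [d (f x) (f y) <= delta * d x y + delta] is only a constraint
    on pairs with [d x y < 2 / delta].  Hence a partition of unity that is
    subordinate to the cover by closed balls of radius [2 / delta], with
    variation less than [delta] on each ball, is a [delta]-partition of unity:
    this is how large scale paracompactness provides [delta]-partitions of
    unity for every [delta > 0] ([delta_partition_exists]).

    The extension hypothesis, applied to the empty subset of [X], pushes such
    a map into the [n]-skeleton and leaves it an [eps]-partition of unity.  A
    point of the [n]-skeleton has at most [n + 1] nonzero barycentric
    coordinates, so each point of [X] lies in at most [n + 1] of the sets of
    the resulting star cover ([skeleton_star_multiplicity]).  Thus [X] has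
    uniformly bounded covers of arbitrarily large Lebesgue number and point
    multiplicity at most [n + 1].

    Such a cover [V] becomes one that witnesses [asdim_le X n] against sets of
    diameter at most [r] when each [B] in [V] is shrunk to the set of points
    whose closed [r]-ball is contained in [B] ([asdim_le_lebesgue]): the
    Lebesgue number makes the shrunken sets cover [X], and if a set [A] of
    diameter at most [r] meets the shrinking of [B], then all of [A] is
    contained in [B].  So, whatever the point [a] of [A], only the shrinkings
    of the sets [B] that contain [a] can meet [A]. *)

Section Shrinking.
Context {R : realType} {X : metricType R}.
Implicit Types (A B : set X) (r : R).

Lemma diam_le r A : 0 <= r -> (forall x y, A x -> A y -> mdist x y <= r) ->
  (diam A <= r%:E)%E.
Proof.
move=> r0 Ar; rewrite /diam ge_max lee_fin r0 /=.
by apply: ge_ereal_sup => _ [[x y] /= [Ax Ay] <-]; rewrite lee_fin Ar.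
Qed.

Lemma mdist_le_diam A x y : A x -> A y -> ((mdist x y)%:E <= diam A)%E.
Proof.
move=> Ax Ay; rewrite /diam le_max; apply/orP; right.
by apply: ereal_sup_ubound; exists (x, y).
Qed.

Lemma diam_subset A B : A `<=` B -> (diam A <= diam B)%E.
Proof.
move=> AB; rewrite /diam ge_max le_max lexx /= le_max; apply/orP; right.
apply: le_ereal_sup => _ [[x y] [Ax Ay] <-].
by exists (x, y) => //; split; exact: AB.
Qed.

Definition cball x r : set X := [set y | mdist x y <= r].

Lemma cball_center x r : 0 <= r -> cball x r x.
Proof. by move=> r0; rewrite /cball /= mdistxx. Qed.

Lemma diam_cball x r : 0 <= r -> (diam (cball x r) <= (2 * r)%:E)%E.
Proof.
move=> r0; apply: diam_le => [|y z]; first by rewrite mulr_ge0.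
rewrite /cball /= => xy xz.
have := metric_triangle y x z; rewrite (metric_sym y x); lra.
Qed.

Lemma cballs_uniformly_bounded_cover r : 0 <= r ->
  uniformly_bounded_cover [set cball x r | x in setT].
Proof.
move=> r0; split; last by exists (2 * r) => _ [x _ <-]; exact: diam_cball.
rewrite /is_cover -subTset => x _.
by exists (cball x r); [exists x|exact: cball_center].
Qed.

Definition shrink r A : set X := [set x | cball x r `<=` A].

Lemma shrink_subset r A : 0 <= r -> shrink r A `<=` A.
Proof. by move=> r0 x; apply; exact: cball_center. Qed.

Lemma meets_shrink_subset r A B : (diam A <= r%:E)%E ->
  A `&` shrink r B !=set0 -> A `<=` B.
Proof.
move=> Ar [x [Ax Bx]] y Ay; apply: Bx.
by rewrite /cball /= -lee_fin (le_trans (mdist_le_diam Ax Ay)).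
Qed.

End Shrinking.

(** The multiplicity is counted at points here, and on the members of the
    given cover in [asdim_le]; shrinking trades the Lebesgue number for the
    passage from points to sets of bounded diameter. *)
Lemma asdim_le_lebesgue (R : realType) (X : metricType R) (n : nat) :
  (forall r : R, 0 < r -> exists V : set (set X),
    [/\ uniformly_bounded_cover V, lebesgue_number_ge r V &
      forall x, ([set B | V B /\ B x] #<= `I_n.+1)%card]) ->
  asdim_le X n.
Proof.
move=> covX U [_ [M UM]].
pose r := Num.max M 1.
have r_ge1 : 1 <= r by rewrite /r le_max lexx orbT.
have r0 : 0 <= r by lra.
have Ur A : U A -> (diam A <= r%:E)%E.
  by move=> /UM /le_trans; apply; rewrite lee_fin /r le_max lexx.
(* Closed r-balls have diameter at most 2r; the Lebesgue condition asks for a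
   strict inequality. *)
have [|V [[_ [N VN]] Vleb Vmult]] := covX (3 * r); first by lra.
exists [set shrink r B | B in V]; split.
  split.
    rewrite /is_cover -subTset => x _.
    have [|B VB xB] := Vleb (cball x r).
      apply: (le_lt_trans (diam_cball x r0)); rewrite lte_fin; lra.
    by exists (shrink r B) => //; exists B.
  exists N => _ [B VB <-].
  by apply: le_trans (VN B VB); apply: diam_subset; exact: shrink_subset.
move=> A UA.
have [[a Aa]|A0] := pselect (A !=set0); last first.
  apply: (@card_le_trans _ _ _ set0); last exact: card_ge0.
  by apply: subset_card_le => B [_ [x [Ax _]]]; apply: A0; exists x.
apply: card_le_trans (Vmult a).
apply: card_le_trans (card_image_le (shrink r) _).
apply: subset_card_le => _ [[B VB <-] AB].
by exists B => //; split => //; exact: meets_shrink_subset (Ur A UA) AB a Aa.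
Qed.

Lemma full_complex_sum1 (R : realType) (S : choiceType)
    (p : full_complex R S) (D : {fset S}) :
  (finsupp p `<=` D)%fset -> \sum_(s <- D) `|p s| = 1.
Proof.
case: p => p /= /[dup] /asboolP[p01 p1] _ pD; rewrite -[RHS]p1.
rewrite -(big_fset_incl _ pD); last first.
  by move=> s _ sp; rewrite fsfun_dflt// normr0.
by apply: eq_bigr => s _; rewrite ger0_norm//; case/andP: (p01 s).
Qed.

Lemma mdist_full_complex_le2 (R : realType) (S : choiceType)
  (p q : full_complex R S) : mdist p q <= 2.
Proof.
change (l1dist p q <= 2).
apply: (@le_trans _ _ (\sum_(s <- (finsupp p `|` finsupp q)%fset)
  (`|p s| + `|q s|))).
  by apply: ler_sum => s _; exact: ler_normB.
by rewrite big_split /= !full_complex_sum1 ?fsubsetUl ?fsubsetUr.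
Qed.

(** The radius [2 / delta] is where [delta * d x y] reaches 2, the largest
    distance in a full complex; beyond it the Lipschitz bound is automatic.  It
    also exceeds [1 / delta], which yields the Lebesgue number. *)
Lemma delta_partition_exists (R : realType) (X : metricType R) (delta : R) :
  large_scale_paracompact X -> [set: X] !=set0 -> 0 < delta ->
  exists (S : choiceType) (K : simplicial_complex S)
    (f : {fun [set: X] >-> realization R K}), delta_partition_of_unity delta f.
Proof.
move=> lspX [x0 _] d0; pose r := 2 / delta.
have r0 : 0 <= r by rewrite /r divr_ge0// ltW.
have [S [K [f [fvar fpos fcov]]]] :=
  lspX _ _ (cballs_uniformly_bounded_cover r0) d0.
exists S, K, f; split => //.
- move=> x y; have [xy|/ltW xy] := leP (mdist x y) r.
    apply: (@le_trans _ _ delta); last first.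
      by rewrite lerDr mulr_ge0 ?mdist_ge0// ltW.
    rewrite -lee_fin; apply: le_trans (ltW fvar).
    apply: ereal_sup_ubound; exists (x, y) => //=.
    by exists (cball x r); split; [exists x|exact: cball_center|].
  apply: (le_trans (mdist_full_complex_le2 _ _)).
  have : 2 <= delta * mdist x y by rewrite mulrC -ler_pdivrMr.
  lra.
- move=> A Ad.
  (* The empty set has diameter 0, but only lies in a member of the star
     cover because that cover is nonempty. *)
  have [x Ax] : exists x, A `<=` cball x r.
    have [[a Aa]|/nonemptyPn->] := pselect (A !=set0); last by exists x0.
    exists a => y Ay; rewrite /cball /= -lee_fin.
    apply: (le_trans (mdist_le_diam Aa Ay)); apply: (le_trans (ltW Ad)).
    by rewrite lee_fin /r ler_peMl ?invr_ge0 ?ler1n// ltW.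
  have [|v Kv vpos] := fpos (cball x r); first by exists x.
  exists (f @^-1` star K v); first by exists v.
  by move=> y /Ax/vpos fyv; split => //; exact: (@funS _ _ _ _ f y I).
Qed.

Lemma skeleton_star_multiplicity (R : realType) (X : metricType R)
    (S : choiceType) (K : simplicial_complex S) (n : nat)
    (h : {fun [set: X] >-> realization R (skeleton n K)}) (x : X) :
  ([set B | star_cover h B /\ B x] #<= `I_n.+1)%card.
Proof.
have [_ hxn] : skeleton_simplices n K (finsupp (h x)) by exact: (@funS _ _ _ _ h x I).
rewrite -card_le_II in hxn; apply: card_le_trans hxn.
have /card_eq_fsetP/card_eqPle[supph _] := erefl #|` finsupp (h x)|.
apply: card_le_trans supph.
apply: card_le_trans
  (card_image_le (fun v => h @^-1` star (skeleton n K) v) _).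
apply: subset_card_le => _ [[v Kv <-] [_ hxv]].
by exists v => //=; rewrite mem_finsupp gt_eqF.
Qed.

Theorem corollary5p3 (R : realType) (X : metricType R) (n : nat) :
  (forall eps : R, 0 < eps ->
   exists2 delta : R, 0 < delta &
   forall (S : choiceType) (K : simplicial_complex S) (A : set X)
     (f : {fun [set: X] >-> realization R K})
     (g : {fun A >-> realization R (skeleton n K)}),
     delta_partition_of_unity delta f ->
     {in A, f =1 g} ->
     exists2 h : {fun [set: X] >-> realization R (skeleton n K)},
       is_filler f g h & delta_partition_of_unity eps h) ->
  large_scale_paracompact X ->
  asdim_le X n.
Proof.
move=> fillX lspX.
have [X0|X0] := pselect ([set: X] !=set0); last first.
  (* The star cover of a map from the empty space may have no member to
     contain the empty set, so this case is separate: the empty family will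
     do. *)
  move=> U _; exists set0; split.
    split; last by exists 0.
    by rewrite /is_cover -subTset => x; case: X0; exists x.
  move=> A _; apply: (@card_le_trans _ _ _ set0); last exact: card_ge0.
  by apply: subset_card_le => B [].
apply: asdim_le_lebesgue => r r0.
have [|delta d0 fill] := fillX r^-1; first by rewrite invr_gt0.
have [S [K [f fdelta]]] := delta_partition_exists lspX X0 d0.
have empty_fun : {homo f : x / set0 x >-> realization R (skeleton n K) x}.
  by [].
have [|h _ [_ hcov hleb]] := fill S K set0 f (mkfun_fun empty_fun) fdelta.
  by move=> x; rewrite in_set0.
exists (star_cover h); split => //; first by rewrite -[r]invrK.
exact: skeleton_star_multiplicity.
Qed.
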